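(* For all positive integers $m,n$, the complete bipartite graph $K_{m,n}$ is $Q$-unique: if $H$ is a finite simple graph with $Q(H;x,y)=Q(K_{m,n};x,y)$, then $H\cong K_{m,n}$.
   Context: For a finite simple graph $G=(V,E)$, the subgraph component polynomial is $Q(G;x,y)=\sum_{X\subseteq V} x^{|X|}y^{k(G[X])}$, where $G[X]$ is the induced subgraph on $X$ and $k(\cdot)$ denotes the number of connected components. *)

(* Defs.v *)
From mathcomp Require Import all_boot all_order all_algebra.

Set Implicit Arguments.
Unset Strict Implicit.
Unset Printing Implicit Defensive.

Import GRing.Theory.
Local Open Scope ring_scope.

Record sgraph := SGraph {
  vertex :> finType;
  adj : rel vertex;
  adj_sym : symmetric adj;
  adj_irrefl : irreflexive adj }.

Section Induced.
Variables (G : sgraph) (X : {set G}).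

Definition ind_adj : rel {v : G | v \in X} :=
  [rel u v | adj (val u) (val v)].

Lemma ind_adj_sym : symmetric ind_adj.
Proof. by move=> u v; exact: adj_sym. Qed.

Lemma ind_adj_irrefl : irreflexive ind_adj.
Proof. by move=> u; exact: adj_irrefl. Qed.

Definition induced : sgraph := SGraph ind_adj_sym ind_adj_irrefl.

End Induced.

(* The graph without vertices has 0 components. *)
Definition num_comp (G : sgraph) : nat := n_comp (@adj G) predT.

(* Integer polynomials in two variables: in {poly {poly int}}, 'X is the
   indeterminate x and the constant polynomial 'Y = 'X%:P is y. *)
Definition Qpoly (G : sgraph) : {poly {poly int}} :=
  \sum_(X : {set G}) 'X ^+ #|X| * 'Y ^+ num_comp (induced X).

Definition isomorphic (G H : sgraph) : Prop :=
  exists2 f : G -> H, bijective f &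
    forall u v : G, adj (f u) (f v) = adj u v.

Definition Q_unique (G : sgraph) : Prop :=
  forall H : sgraph, Qpoly H = Qpoly G -> isomorphic H G.

Section CompleteBipartite.
Variables m n : nat.

Definition Kmn_adj : rel ('I_m + 'I_n)%type :=
  fun u v => match u, v with
             | inl _, inr _ | inr _, inl _ => true
             | _, _ => false
             end.

Lemma Kmn_adj_sym : symmetric Kmn_adj.
Proof. by move=> [i|i] [j|j]. Qed.

Lemma Kmn_adj_irrefl : irreflexive Kmn_adj.
Proof. by move=> [i|i]. Qed.

Definition Kmn : sgraph := SGraph Kmn_adj_sym Kmn_adj_irrefl.

End CompleteBipartite.

(* Main.v *)
(** Every induced subgraph of [Kmn m n] is connected or edgeless, and [Q]
    detects this property, so in a graph [H] with the same [Q] a vertex [w] and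
    an edge [uv] always span a connected subgraph: [w] is adjacent to [u] or to
    [v].  Hence an independent set [A] of maximal size [maxn m n] is completely
    joined to its complement, and every independent set lies in [A] or in
    [~: A].  The number of independent sets, also read off [Q], is as large as
    this allows only if [~: A] is independent as well. *)
Require Import Defs.
From mathcomp Require Import all_boot all_order all_algebra.
From mathcomp Require Import zify.

Set Implicit Arguments.
Unset Strict Implicit.
Unset Printing Implicit Defensive.

(** * Component counts and independent sets *)

Lemma connect_adj_sym (G : sgraph) : connect_sym (@adj G).
Proof. exact/sym_connect_sym/adj_sym. Qed.

Lemma num_compE (G : sgraph) :
  num_comp G = #|[set x | fingraph.root (@adj G) x == x]|.
Proof. by apply: eq_card => x; rewrite !inE andbT. Qed.

Lemma num_comp_le (G : sgraph) : num_comp G <= #|G|.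
Proof. exact: max_card. Qed.

(** Components are counted by their roots, so equality makes every vertex its own root, whereas
    adjacent vertices share a root. *)
Lemma num_comp_edgeless (G : sgraph) :
  reflect (forall u v : G, ~~ adj u v) (num_comp G == #|G|).
Proof.
rewrite num_compE -cardsT eqn_leq subset_leq_card ?subsetT //=.
apply: (iffP idP) => [cardG u v | noE].
  have /eqP/setP rootT : [set x | fingraph.root (@adj G) x == x] == [set: G].
    by rewrite eqEcard subsetT.
  have rootE x : fingraph.root (@adj G) x = x by have := rootT x; rewrite !inE => /eqP.
  apply/negP => uv; have := connect1 uv.
  rewrite -(root_connect (@connect_adj_sym G)) !rootE => /eqP euv.
  by rewrite euv adj_irrefl in uv.
apply/subset_leq_card/subsetP => x _; rewrite inE.
have /connectP[[|y p] /=] := connect_root (@adj G) x; first by move=> _ ->.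
by rewrite (negPf (noE _ _)).
Qed.

Lemma num_comp1_connect (G : sgraph) (u v : G) :
  num_comp G = 1 -> connect (@adj G) u v.
Proof.
rewrite num_compE => /eqP/cards1P[r /setP rP].
have rootE x : fingraph.root (@adj G) x = r.
  apply/eqP; have := rP (fingraph.root (@adj G) x).
  by rewrite !inE (root_root (@connect_adj_sym G)) eqxx.
by rewrite -(root_connect (@connect_adj_sym G)) !rootE.
Qed.

Lemma connected_num_comp (G : sgraph) (u : G) :
  (forall v, connect (@adj G) u v) -> num_comp G = 1.
Proof.
move=> cu; rewrite -(n_comp_connect (@connect_adj_sym G) u).
by apply: eq_n_comp_r => v; rewrite !inE [RHS]cu.
Qed.

(** Independence is phrased through the two exponents of [Qpoly], so that counts of independent sets
    are sums of its coefficients; [indepP] recovers the usual meaning. *)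
Definition indep (G : sgraph) (X : {set G}) : bool :=
  num_comp (induced X) == #|X|.

Lemma card_induced (G : sgraph) (X : {set G}) : #|induced X| = #|X|.
Proof. by rewrite card_sig; apply: eq_card => x; rewrite !inE. Qed.

Lemma indepP (G : sgraph) (X : {set G}) :
  reflect {in X &, forall u v, ~~ adj u v} (indep X).
Proof.
rewrite /indep -card_induced; apply: (iffP (num_comp_edgeless _)) => noE u v.
  by move=> uX vX; apply: (noE (exist _ u uX) (exist _ v vX)).
exact: noE (valP u) (valP v).
Qed.

Lemma indepPn (G : sgraph) (X : {set G}) :
  reflect (exists u v, [/\ u \in X, v \in X & adj u v]) (~~ indep X).
Proof.
apply: (iffP idP) => [dX | [u [v [uX vX uv]]]]; last first.
  by apply/negP => /indepP/(_ u v uX vX); rewrite uv.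
have /existsP[u /existsP[v /and3P[? ? ?]]] :
  [exists u, exists v, [&& u \in X, v \in X & adj u v]]; last by exists u, v.
apply: contraNT dX => /existsPn noE; apply/indepP => u v uX vX.
by have /existsPn/(_ v) := noE u; rewrite uX vX.
Qed.

(** * Invariants determined by the polynomial *)

Section Coefficients.
Import GRing.Theory.
Local Open Scope ring_scope.

Lemma Qpoly_coef (G : sgraph) (i j : nat) :
  (Qpoly G)`_i`_j =
  #|[set X : {set G} | (#|X| == i) && (num_comp (induced X) == j)]|%:R.
Proof.
rewrite /Qpoly !coef_sum -sum1dep_card natr_sum [RHS]big_mkcond /=.
apply: eq_bigr => X _; rewrite -rmorphXn coefMC coefXn mulr_natl coefMn coefXn.
by rewrite [i == _]eq_sym [j == _]eq_sym; do 2 case: (_ == _).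
Qed.

End Coefficients.

Section SameQ.
Variables G H : sgraph.
Hypothesis eqQ : Qpoly H = Qpoly G.

Lemma eqQ_card_coef (i j : nat) :
  #|[set X : {set H} | (#|X| == i) && (num_comp (induced X) == j)]| =
  #|[set X : {set G} | (#|X| == i) && (num_comp (induced X) == j)]|.
Proof.
have := congr1 (fun p : {poly {poly int}} => p`_i`_j)%R eqQ.
by rewrite !Qpoly_coef => /eqP; rewrite Num.Theory.eqr_nat => /eqP.
Qed.

(** Such a count is a finite sum of coefficients of [Qpoly]; the invariants below arise by choosing
    [P]. *)
Lemma eqQ_card_sets (P : nat -> nat -> bool) :
  #|[set X : {set H} | P #|X| (num_comp (induced X))]| =
  #|[set X : {set G} | P #|X| (num_comp (induced X))]|.
Proof.
pose M := (#|G| + #|H|).+1.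
(* [M] exceeds every exponent occurring in either graph, so both counts become sums over the same
   range. *)
have sumE (K : sgraph) : #|K| < M ->
    #|[set X : {set K} | P #|X| (num_comp (induced X))]| =
    \sum_(i < M) \sum_(j < M | P i j)
      #|[set X : {set K} | (#|X| == i) && (num_comp (induced X) == j)]|.
  move=> ltKM.
  have ltX (X : {set K}) : #|X| < M by exact: leq_ltn_trans (max_card _) ltKM.
  have ltc (X : {set K}) : num_comp (induced X) < M.
    by apply: leq_ltn_trans (ltX X); rewrite -card_induced num_comp_le.
  rewrite -sum1dep_card.
  rewrite (partition_big (fun X : {set K} => Ordinal (ltX X)) xpredT) //=.
  apply: eq_bigr => i _.
  rewrite (partition_big (fun X : {set K} => Ordinal (ltc X)) (fun j => P i j)) /=.
    apply: eq_bigr => j Pij; rewrite -sum1dep_card; apply: eq_bigl => X.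
    rewrite -!val_eqE /= -andbA andb_idl // => /andP[/eqP-> /eqP->] //.
  by move=> X /andP[PX /eqP <-].
rewrite !sumE; [|lia|lia].
by apply: eq_bigr => i _; apply: eq_bigr => j _; exact: eqQ_card_coef.
Qed.

Lemma eqQ_card : #|H| = #|G|.
Proof.
have := eqQ_card_sets (fun _ _ => true).
have cardE (K : sgraph) : #|[set X : {set K} | true]| = 2 ^ #|K|.
  rewrite -cardsT -card_powerset; apply: eq_card => X.
  by rewrite !inE subsetT.
by rewrite !cardE => /eqP; rewrite eqn_exp2l // => /eqP.
Qed.

Lemma eqQ_card_indep :
  #|[set X : {set H} | indep X]| = #|[set X : {set G} | indep X]|.
Proof. exact: eqQ_card_sets (fun i j => j == i). Qed.

Lemma eqQ_ex_indep (k : nat) :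
  (exists2 X : {set H}, indep X & #|X| = k) <->
  (exists2 X : {set G}, indep X & #|X| = k).
Proof.
have exE (K : sgraph) : (exists2 X : {set K}, indep X & #|X| = k) <->
    0 < #|[set X : {set K} | (#|X| == k) && (num_comp (induced X) == #|X|)]|.
  split=> [[X iX kX] | /card_gt0P[X]].
    by apply/card_gt0P; exists X; rewrite inE kX eqxx -kX.
  by rewrite inE => /andP[/eqP kX iX]; exists X.
by rewrite !exE (eqQ_card_sets (fun i j => (i == k) && (j == i))).
Qed.

(** The sets with neither [#|X|] components nor exactly one are counted by the polynomial; there are
    none in [G], hence none in [H]. *)
Lemma eqQ_connected_or_indep :
  (forall X : {set G}, ~~ indep X -> num_comp (induced X) = 1) ->
  forall X : {set H}, ~~ indep X -> num_comp (induced X) = 1.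
Proof.
move=> conG X dX; apply/eqP/negPn/negP => cX.
have /eqP := eqQ_card_sets (fun i j => (j != i) && (j != 1)).
have /eqP -> :
    #|[set X : {set G} | (num_comp (induced X) != #|X|)
                         && (num_comp (induced X) != 1)]| == 0.
  rewrite cards_eq0 -subset0; apply/subsetP => Y; rewrite !inE.
  by case/andP=> /conG->.
rewrite cards_eq0 => /eqP/setP/(_ X); rewrite !inE cX andbT.
by move: dX; rewrite /indep => ->.
Qed.

End SameQ.

(** The set of [u], [v], [w] contains an edge, hence is connected, and the first step of a path from
    [w] to [u] inside it ends at [u] or [v]. *)
Lemma edge_dominates (G : sgraph) :
  (forall X : {set G}, ~~ indep X -> num_comp (induced X) = 1) ->
  forall u v w : G, adj u v -> adj w u || adj w v.
Proof.
move=> conG u v w uv.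
have [-> | nwu] := eqVneq w u; first by rewrite uv orbT.
pose X := [set u; v; w].
have [uX vX wX] : [/\ u \in X, v \in X & w \in X] by rewrite !inE !eqxx !orbT.
have cX : num_comp (induced X) = 1 by apply/conG/indepPn; exists u, v.
have /connectP[[|z p] /=] :=
  num_comp1_connect (exist _ w wX : induced X) (exist _ u uX) cX.
  by move=> _ [] euw; rewrite euw eqxx in nwu.
case: z => z zX /= /andP[wz _] _; move: zX wz; rewrite /ind_adj /= !inE.
by case/orP=> [/orP[]|] /eqP-> => [->|->|]; rewrite ?orbT // adj_irrefl.
Qed.

(** * A vertex set completely joined to its complement *)

Section Join.
Variables (G : sgraph) (A : {set G}).
Hypothesis joinA : forall u v, u \in A -> v \notin A -> adj u v.

Lemma join_indep_sub (X : {set G}) :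
  indep X -> (X \subset A) || (X \subset ~: A).
Proof.
move/indepP=> iX; apply/norP => -[/subsetPn[v vX vA] /subsetPn[u uX]].
by rewrite inE negbK => uA; have := iX u v uX vX; rewrite joinA.
Qed.

Lemma join_isomorphic :
  indep A -> indep (~: A) -> isomorphic G (Kmn #|A| #|~: A|).
Proof.
move=> /indepP iA /indepP iB.
(* Enumerating both sides gives the map out of the complete bipartite graph; the isomorphism sought
   is its inverse. *)
pose g (x : Kmn #|A| #|~: A|) : G :=
  match x with inl i => enum_val i | inr j => enum_val j end.
have gA i : g (inl i) \in A := enum_valP i.
have gB j : g (inr j) \in ~: A := enum_valP j.
have gBA j : g (inr j) \notin A by rewrite -in_setC gB.
have g_inj : injective g.
  move=> [i|i] [j|j] // eg; first by rewrite (enum_val_inj eg).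
  - by have := gA i; rewrite eg (negPf (gBA _)).
  - by have := gA j; rewrite -eg (negPf (gBA _)).
  - by rewrite (enum_val_inj eg).
have g_adj x y : adj (g x) (g y) = adj x y.
  case: x y => [i|i] [j|j] /=.
  - exact/negbTE/(iA _ _ (gA i) (gA j)).
  - exact: joinA (gA i) (gBA j).
  - by rewrite adj_sym; exact: joinA (gA j) (gBA i).
  - exact/negbTE/(iB _ _ (gB i) (gB j)).
have [|f gK fK] := inj_card_bij g_inj.
  by rewrite card_sum !card_ord cardsC.
exists f; first by exists g.
by move=> u v; rewrite -g_adj !fK.
Qed.

End Join.

(** The two powersets share only the empty set, which accounts for the subtracted 1. *)
Lemma card_powersetU_setC (T : finType) (A : {set T}) :
  #|powerset A :|: powerset (~: A)| = 2 ^ #|A| + 2 ^ #|~: A| - 1.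
Proof.
rewrite cardsU -!card_powerset; congr (_ - _).
apply/eqP/cards1P; exists set0; apply/setP => X.
by rewrite !inE -subsetI setICr subset0.
Qed.

(** * Independent and connected sets in complete bipartite graphs *)

Section CompleteBipartite.
Variables m n : nat.

Definition Kmn_left : {set Kmn m n} := [set x | if x is inl _ then true else false].

Lemma Kmn_left_card : #|Kmn_left| = m.
Proof.
rewrite -[RHS]card_ord -(card_imset _ (@inl_inj 'I_m 'I_n)).
apply: eq_card => -[i|j]; rewrite !inE; first by rewrite imset_f.
by apply/esym/negbTE/imsetP => -[].
Qed.

Lemma Kmn_right_card : #|~: Kmn_left| = n.
Proof. by rewrite cardsCs setCK Kmn_left_card card_sum !card_ord addKn. Qed.

Lemma Kmn_left_indep : indep Kmn_left.
Proof. by apply/indepP => -[i|i] [j|j]; rewrite !inE. Qed.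

Lemma Kmn_right_indep : indep (~: Kmn_left).
Proof. by apply/indepP => -[i|i] [j|j]; rewrite !inE. Qed.

Lemma Kmn_join (u v : Kmn m n) : u \in Kmn_left -> v \notin Kmn_left -> adj u v.
Proof. by case: u v => [i|i] [j|j]; rewrite !inE. Qed.

Lemma Kmn_indepE (X : {set Kmn m n}) :
  indep X = (X \subset Kmn_left) || (X \subset ~: Kmn_left).
Proof.
apply/idP/idP => [|/orP[] /subsetP sX]; first exact: join_indep_sub Kmn_join X.
  apply/indepP => u v /sX uL /sX vL; exact: (indepP _ Kmn_left_indep).
apply/indepP => u v /sX uL /sX vL; exact: (indepP _ Kmn_right_indep).
Qed.

Lemma Kmn_indep_card (X : {set Kmn m n}) : indep X -> #|X| <= maxn m n.
Proof.
by rewrite Kmn_indepE leq_max => /orP[] /subset_leq_card;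
  rewrite ?Kmn_left_card ?Kmn_right_card => ->; rewrite ?orbT.
Qed.

Lemma Kmn_count_indep :
  #|[set X : {set Kmn m n} | indep X]| = 2 ^ m + 2 ^ n - 1.
Proof.
have := card_powersetU_setC Kmn_left.
rewrite Kmn_left_card Kmn_right_card => <-.
by apply: eq_card => X; rewrite !inE Kmn_indepE.
Qed.

Lemma Kmn_connected_or_indep (X : {set Kmn m n}) :
  ~~ indep X -> num_comp (induced X) = 1.
Proof.
case/indepPn=> u [v [uX vX uv]].
pose u' : induced X := exist _ u uX; pose v' : induced X := exist _ v vX.
have cuv : connect (@adj (induced X)) u' v' by apply: connect1.
apply: (@connected_num_comp _ u') => -[w wX].
(* A vertex not adjacent to [u] lies on the side of [u], hence is adjacent to [v]. *)
have [uw | nuw] := boolP (adj u w); first exact: connect1.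
apply: connect_trans cuv (connect1 _).
by rewrite /= /ind_adj /=; case: u v w uv nuw {u' v' uX vX wX} => [?|?] [?|?] [?|?].
Qed.

End CompleteBipartite.

Theorem theorem4p5 (m n : nat) (hm : (0 < m)%N) (hn : (0 < n)%N) :
  Q_unique (Kmn m n).
Proof.
move=> H eqQ.
have dom := edge_dominates (eqQ_connected_or_indep eqQ (@Kmn_connected_or_indep m n)).
(* The larger side of [Kmn m n] provides an independent set of this size, and [Qpoly] records the
   sizes that occur. *)
have [A iA cA] : exists2 A : {set H}, indep A & #|A| = maxn m n.
  apply/(eqQ_ex_indep eqQ); have [_|_] := leqP m n.
    by exists (~: Kmn_left m n); [exact: Kmn_right_indep | exact: Kmn_right_card].
  by exists (Kmn_left m n); [exact: Kmn_left_indep | exact: Kmn_left_card].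
have maxA (X : {set H}) : indep X -> #|X| <= #|A|.
  move=> iX; have [|Y iY <-] := (eqQ_ex_indep eqQ #|X|).1; first by exists X.
  by rewrite cA Kmn_indep_card.
have joinA u v : u \in A -> v \notin A -> adj u v.
  move=> uA vA.
  (* By maximality of [A], adding [v] creates an edge, which must join [v] to some [a] in [A]. This
     edge dominates [u], and [u] is not adjacent to [a]. *)
  have /indepPn[x [y [xvA yvA xy]]] : ~~ indep (v |: A).
    by apply/negP => /maxA; rewrite cardsU1 vA ltnn.
  have [a aA va] : exists2 a, a \in A & adj v a.
    move: xvA yvA xy; rewrite !inE => /predU1P[->|xA] /predU1P[->|yA].
    - by rewrite adj_irrefl.
    - by exists y.
    - by rewrite adj_sym; exists x.
    - by rewrite (negPf (indepP _ iA _ _ _ _)).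
  by have := dom _ _ u va; rewrite (negPf (indepP _ iA _ _ uA aA)) orbF.
have cB : #|~: A| = minn m n.
  have := cardsC A; rewrite cA (eqQ_card eqQ) card_sum !card_ord; lia.
have iB : indep (~: A).
  have sub : [set X : {set H} | indep X] \subset powerset A :|: powerset (~: A).
    by apply/subsetP => X; rewrite !inE; exact: join_indep_sub joinA X.
  (* Both families have [2 ^ m + 2 ^ n - 1] members, so the inclusion is an equality and [~: A]
     itself is independent. *)
  have /eqP eqI : [set X : {set H} | indep X] == powerset A :|: powerset (~: A).
    rewrite eqEcard sub (eqQ_card_indep eqQ) card_powersetU_setC cA cB.
    by rewrite Kmn_count_indep /=; case: (leqP m n) => _; [rewrite addnC|].
  by have /setP/(_ (~: A)) := eqI; rewrite !inE subxx orbT.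
(* [A] is the larger side, so for [m <= n] it must come second: the join is then applied to
   [~: A]. *)
have [lemn | ltnm] := leqP m n.
  have joinB u v : u \in ~: A -> v \notin ~: A -> adj u v.
    by rewrite !inE negbK adj_sym => *; apply: joinA.
  have := join_isomorphic joinB iB; rewrite setCK cA cB.
  by rewrite (maxn_idPr lemn) (minn_idPl lemn); apply.
have := join_isomorphic joinA iA iB; rewrite cA cB.
by rewrite (maxn_idPl (ltnW ltnm)) (minn_idPr (ltnW ltnm)).
Qed.
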